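(* For every positive integer $k$, $\mathbb{N}\langle k+1\rangle\in\mathrm{QCB}_0(\mathbf{\Pi}^1_k)\setminus\mathrm{QCB}_0(\mathbf{\Sigma}^1_k)$.
   Context: $\mathrm{QCB}_0$ is the cartesian closed category of $T_0$-spaces that are topological quotients of countably based spaces, with continuous maps; for $\mathrm{QCB}_0$-spaces $X,Y$ the exponential $Y^X$ is the set of continuous functions $X\to Y$ with the sequentialization of the compact-open topology. The Kleene–Kreisel spaces are defined by $\mathbb{N}\langle0\rangle=\omega$ (discrete) and $\mathbb{N}\langle k+1\rangle=\omega^{\mathbb{N}\langle k\rangle}$ ($\mathrm{QCB}_0$-exponential). Let $\mathcal{N}=\omega^\omega$ be the Baire space. For a space $X$: $\mathbf{\Sigma}^0_1(X)$ = open sets; $\mathbf{\Sigma}^0_2(X)$ = countable unions of differences $U\setminus V$ of open sets; $\mathbf{\Pi}^0_2(X)$ = complements of these; $\mathbf{\Sigma}^1_1(X)=\{pr_X(A)\mid A\in\mathbf{\Pi}^0_2(\mathcal{N}\times X)\}$, $\mathbf{\Sigma}^1_{n+1}(X)=\{pr_X(A)\mid A\in\mathbf{\Pi}^1_n(\mathcal{N}\times X)\}$ with $pr_X(A)=\{x\mid\exists p\in\mathcal{N}\,(p,x)\in A\}$; $\mathbf{\Pi}^1_n(X)$ = complements of $\mathbf{\Sigma}^1_n(X)$-sets. A representation of $X$ is a surjection $\delta$ from $\mathrm{dom}(\delta)\subseteq\mathcal{N}$ onto $X$; it is admissible if continuous and every continuous $\nu:Z\to X$ from a zero-dimensional countably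 based $T_0$-space $Z$ factors as $\nu=\delta g$ with $g:Z\to\mathrm{dom}(\delta)$ continuous. $\mathit{EQ}(\delta)=\{(p,q)\mid p,q\in\mathrm{dom}(\delta),\delta(p)=\delta(q)\}$. $\mathrm{QCB}_0(\Gamma)$ is the class of spaces having an admissible representation $\delta$ with $\mathit{EQ}(\delta)\in\Gamma(\mathcal{N}\times\mathcal{N})$. *)

(* Defs.v *)
(* Built on MathComp and MathComp-Analysis. *)
From HB Require Import structures.
From mathcomp Require Import all_boot all_classical all_reals.
From mathcomp Require Import topology.

Set Implicit Arguments.
Unset Strict Implicit.
Unset Printing Implicit Defensive.

Local Open Scope classical_set_scope.

(* Sequentialization: the open sets are the sequentially open sets of [T]. *)
Definition sequentialization (T : Type) : Type := T.

Section Sequentialization.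
Variable T : topologicalType.

Definition seq_open (A : set T) : Prop :=
  forall (u : nat -> T) (l : T), u @ \oo --> l -> A l ->
    \forall n \near \oo, A (u n).

Lemma seq_openT : seq_open setT.
Proof. by move=> u l _ _; exact: nearW. Qed.

Lemma seq_openI : setI_closed seq_open.
Proof.
by move=> A B oA oB u l ul [Al Bl]; apply: filterI; [exact: oA ul Al|exact: oB ul Bl].
Qed.

Lemma seq_open_bigU (I : Type) (f : I -> set T) :
  (forall i, seq_open (f i)) -> seq_open (\bigcup_i f i).
Proof.
move=> of_ u l ul [i _ fil]; apply: filterS (of_ i u l ul fil) => n fiun.
by exists i.
Qed.

HB.instance Definition _ := Choice.on (sequentialization T).
HB.instance Definition _ := isOpenTopological.Build (sequentialization T)
  seq_openT seq_openI seq_open_bigU.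

End Sequentialization.

(* The type [continuousType X Y] of continuous maps with the subspace topology
   inherited from the compact-open topology on all maps. *)
Definition cts_compact_open (X Y : topologicalType) : topologicalType :=
  @initial_topology (continuousType X Y) {compact-open, X -> Y}
    (fun f => (f : X -> Y)).

Definition qcb_exp (X Y : topologicalType) : topologicalType :=
  sequentialization (cts_compact_open X Y).

Fixpoint kleene_kreisel (k : nat) : topologicalType :=
  if k is n.+1 then qcb_exp (kleene_kreisel n) nat else nat.

Definition baire : topologicalType := {ptws nat -> nat}.

Definition Sigma02 (X : topologicalType) (A : set X) : Prop :=
  exists U V : nat -> set X,
    [/\ forall i, open (U i), forall i, open (V i) &
        A = \bigcup_i (U i `\` V i)].

Definition pr (X : topologicalType) (A : set (baire * X)) : set X :=
  [set x | exists p, A (p, x)].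

(* [Sigma1 n] is the projective class Sigma^1_n for n >= 1. The value at
   n = 0 is set to Sigma^0_2 so that the step from 0 to 1, projecting the
   complements of Sigma^0_2 sets, gives Sigma^1_1. *)
Fixpoint Sigma1 (n : nat) (X : topologicalType) (A : set X) : Prop :=
  if n is m.+1 then
    exists2 B : set (baire * X), Sigma1 m (~` B) & A = pr B
  else Sigma02 A.

Definition Pi1 (n : nat) (X : topologicalType) (A : set X) : Prop :=
  Sigma1 n (~` A).

(* Existence of a base of clopen sets; the library's [zero_dimensional] only
   asks that points be separated by clopen sets. *)
Definition clopen_based (Z : topologicalType) : Prop :=
  exists2 B : set (set Z), B `<=` @clopen Z & basis B.

(* A partial map from [baire] to [X] is a map on [set_type D], which carries
   the subspace topology. *)
Definition representation (X : topologicalType) (D : set baire)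
    (delta : D -> X) : Prop :=
  forall x : X, exists p : D, delta p = x.

Definition admissible (X : topologicalType) (D : set baire)
    (delta : D -> X) : Prop :=
  continuous delta /\
  forall Z : topologicalType,
    clopen_based Z -> @second_countable Z -> kolmogorov_space Z ->
    forall nu : Z -> X, continuous nu ->
    exists2 g : Z -> D, continuous g & forall z, nu z = delta (g z).

Definition EQ (X : topologicalType) (D : set baire) (delta : D -> X) :
    set (baire * baire) :=
  [set pq | exists p q : D, pq = (\val p, \val q) /\ delta p = delta q].

Definition quotient_map (W X : topologicalType) (q : W -> X) : Prop :=
  (forall x : X, exists w : W, q w = x) /\
  forall U : set X, open U <-> open (q @^-1` U).

Definition QCB0 (X : topologicalType) : Prop :=
  kolmogorov_space X /\
  exists (W : topologicalType) (q : W -> X),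
    @second_countable W /\ quotient_map q.

Definition QCB0_class (Gamma : forall Y : topologicalType, set (set Y))
    (X : topologicalType) : Prop :=
  QCB0 X /\
  exists (D : set baire) (delta : D -> X),
    [/\ representation delta, admissible delta &
        Gamma (baire * baire)%type (EQ delta)].

(* Main.v *)
(* Upper bound: [f] in N<k+1> is named by any [p] coding a partial continuous
   map that sends every name of [x] to [f x]; equality of two names is then a
   universal quantification over the equality relation of N<k>, which raises
   the class by one step from Pi^0_2 at N<1>. Admissibility uses that compact
   subsets of N<k> are sequentially compact, as N<k> injects continuously into
   the Baire space by evaluation on a dense sequence.

   Lower bound: let [d] be dense in N<k>, let [e f i = f (d i)] on N<k+1>. Every
   Sigma^1_(k+1) set of reals is [{x | exists f in N<k+1>, (x, e f) in C}]
   with [C] closed, and [C] has a code [c]. The map sending [f] to the first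
   time at which [(x, e f)] leaves [C] is continuous if [x] is outside the set,
   and otherwise is unbounded near some [f]. So if it is defined on a dense
   sequence [d'] of N<k+1>, its values there extend to an element of N<k+2>
   exactly when [x] is outside. This carries the coding from [k] to [k+1], and,
   on the diagonal [x = c], contradicts the Sigma^1_(k+1) definability of the
   range of N<k+2> under evaluation on [d'], which a Sigma^1_(k+1) equality
   relation would give. *)
From HB Require Import structures.
Require Import Defs.
From mathcomp Require Import all_boot all_classical all_reals topology.

Set Implicit Arguments.
Unset Strict Implicit.
Unset Printing Implicit Defensive.

Local Open Scope classical_set_scope.

(** * The Baire space *)

Definition agree (n : nat) (p q : nat -> nat) := forall i, i < n -> p i = q i.

Lemma agreexx n p : agree n p p.
Proof. by []. Qed.

Lemma agree_sym n p q : agree n p q -> agree n q p.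
Proof. by move=> h i /h. Qed.

Lemma agree_trans n p q r : agree n p q -> agree n q r -> agree n p r.
Proof. by move=> h1 h2 i ilt; rewrite h1// h2. Qed.

Lemma agree_le m n p q : m <= n -> agree n p q -> agree m p q.
Proof. by move=> mn h i im; apply: h; exact: leq_trans mn. Qed.

Arguments agreexx : clear implicits.
Arguments agree_sym {n p q} _ _ _.
Arguments agree_trans {n p q r} _ _ _ _.
Arguments agree_le {m n p q} _ _ _ _.

Lemma nbhs_natP (n : nat) (A : set nat) : nbhs n A <-> A n.
Proof. by rewrite nbhs_principalE; exact: principal_filterP. Qed.

Lemma cvg_natP (T : Type) (F : set_system T) {FF : Filter F} (f : T -> nat) (l : nat) :
  (f @ F --> l <-> \forall x \near F, f x = l).
Proof.
split=> [fl|h A /nbhs_natP Al].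
  by apply: (fl [set l]); exact/nbhs_natP.
by apply: filterS h => x /= ->.
Qed.

Lemma continuous_natP (X : topologicalType) (f : X -> nat) :
  continuous f <-> forall x, \forall y \near x, f y = f x.
Proof. split=> h x.
  exact: (@cvg_natP _ (nbhs x) _ f (f x)).1 (h x).
exact: (@cvg_natP _ (nbhs x) _ f (f x)).2 (h x). Qed.

Lemma nbhs_agree (p : baire) n : nbhs p (agree n p : set baire).
Proof.
elim: n => [|n IH]; first exact: filterE.
have nb : nbhs p [set q : baire | q n = p n].
  apply: (@proj_continuous nat (fun=> nat) n p [set p n]).
  exact/nbhs_natP.
apply: filterS (filterI IH nb) => q [pq qn] i.
by rewrite ltnS leq_eqVlt => /predU1P[->|/pq//]; rewrite qn.
Qed.

(** Counterexamples chosen in ever smaller cylinders around [p] converge to [p] coordinatewise, so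
    they cannot avoid a neighbourhood of [p]. *)
Lemma nbhs_baireP (p : baire) (A : set baire) :
  nbhs p A <-> exists n, forall q, agree n p q -> A q.
Proof.
split=> [pA|[n nA]]; last exact: filterS (nbhs_agree p n).
apply: contrapT => /forallNP noN.
have /choice[u hu] : forall n, exists q : baire, agree n p q /\ ~ A q.
  by move=> n; have /existsNP[q /not_implyP] := noN n; exists q.
have up : u @ \oo --> p.
  apply/cvg_sup => i V [/= _ [[W _ <-] Wp WV]].
  by exists i.+1 => // n /= ni; apply: WV => /=; rewrite -(hu n).1.
have [n _ /(_ n (leqnn n))] := up _ pA.
by have [_] := hu n.
Qed.

Lemma cvg_baire_coord (T : Type) (F : set_system T) {FF : Filter F}
    (f : T -> baire) (l : baire) :
  (forall i, \forall x \near F, f x i = l i) -> f @ F --> l.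
Proof.
move=> h A /nbhs_baireP[n nA].
have : \forall x \near F, agree n l (f x).
  elim: {nA}n => [|n IH]; first exact: filterE.
  apply: filterS2 IH (h n) => x pq qn i.
  by rewrite ltnS leq_eqVlt => /predU1P[->|/pq//]; rewrite qn.
by apply: filterS => x; exact: nA.
Qed.

Lemma nbhs_baire2P (p q : baire) (A : set (baire * baire)%type) :
  nbhs (p, q) A <-> exists n, forall p' q', agree n p p' -> agree n q q' ->
    A (p', q').
Proof.
split=> [[[P Q] /= [/nbhs_baireP[m mP] /nbhs_baireP[n nQ]] PQA]|[n nA]].
  exists (maxn m n) => p' q' pp' qq'; apply: PQA; split=> /=.
    by apply: mP; apply: agree_le pp'; rewrite leq_maxl.
  by apply: nQ; apply: agree_le qq'; rewrite leq_maxr.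
exists (agree n p : set baire, agree n q : set baire).
  by split=> /=; apply: nbhs_agree.
by move=> [p' q'] [/= ? ?]; exact: nA.
Qed.

Lemma nbhs_initialP (S : choiceType) (T : topologicalType) (f : S -> T)
    (s : initial_topology f) (A : set S) :
  nbhs s A <-> exists2 B, nbhs (f s) B & f @^-1` B `<=` A.
Proof.
split=> [[_ [[B oB <-] Bs BA]]|[B fsB BA]].
  by exists B => //; exact: open_nbhs_nbhs.
by apply: filterS BA _; exact: (@initial_continuous S T f s B fsB).
Qed.

Lemma nbhs_set_typeP (D : set baire) (p : D) (A : set D) :
  nbhs p A <-> exists n, forall q : D, agree n (\val p) (\val q) -> A q.
Proof.
split=> [/nbhs_initialP[B /nbhs_baireP[n nB] BA]|[n nA]].
  by exists n => q pq; apply: BA; exact: nB.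
apply/nbhs_initialP; exists (agree n (\val p) : set baire); first exact: nbhs_agree.
by move=> q; exact: nA.
Qed.

Lemma cvg_set_typeP (D : set baire) (T : Type) (F : set_system T)
    {FF : Filter F} (f : T -> D) (l : D) :
  (f @ F --> l <-> forall n, \forall x \near F, agree n (\val l) (\val (f x))).
Proof.
split=> [fl n|h A /nbhs_set_typeP[n nA]].
  apply: (fl [set q : D | agree n (\val l) (\val q)]).
  by apply/nbhs_set_typeP; exists n.
by apply: filterS (h n) => x; exact: nA.
Qed.

Lemma continuous_compT (X Y Z : topologicalType) (f : X -> Y) (g : Y -> Z) :
  continuous f -> continuous g -> continuous (g \o f).
Proof. by move=> cf cg x; apply: continuous_comp; [exact: cf|exact: cg]. Qed.

Lemma continuous_fst (X Y : topologicalType) : continuous (@fst X Y).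
Proof. by move=> z; exact: cvg_fst. Qed.

Lemma continuous_snd (X Y : topologicalType) : continuous (@snd X Y).
Proof. by move=> z; exact: cvg_snd. Qed.

Lemma continuous_pair (X Y Z : topologicalType) (f : X -> Y) (g : X -> Z) :
  continuous f -> continuous g -> continuous (fun x => (f x, g x)).
Proof. by move=> cf cg x; apply: cvg_pair; [exact: cf|exact: cg]. Qed.

(** * Closure properties of the projective classes *)

Lemma Sigma02_setU (X : topologicalType) (A B : set X) :
  Sigma02 A -> Sigma02 B -> Sigma02 (A `|` B).
Proof.
move=> [U [V [oU oV ->]]] [U' [V' [oU' oV' ->]]].
exists (fun n => if odd n then U n./2 else U' n./2).
exists (fun n => if odd n then V n./2 else V' n./2).
split=> [n|n|]; [by case: ifP|by case: ifP|].
apply/seteqP; split=> x /=.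
  move=> [[n _ h]|[n _ h]].
    by exists n.*2.+1 => //=; rewrite odd_double/= uphalf_double.
  by exists n.*2 => //=; rewrite odd_double doubleK.
by move=> [n _ /=]; case: ifP => _ h; [left|right]; exists n./2.
Qed.

Lemma Sigma02_setI_closed (X : topologicalType) (A B : set X) :
  Sigma02 A -> closed B -> Sigma02 (A `&` B).
Proof.
move=> [U [V [oU oV ->]]] cB; exists U, (fun i => V i `|` ~` B); split=> //.
  by move=> i; apply: openU => //; exact: closed_openC.
apply/seteqP; split=> x /=.
  by move=> [[n _ [Ux Vx]] Bx]; exists n => //; split => // -[].
move=> [n _ [Ux /not_orP[Vx /contrapT Bx]]]; split=> //; by exists n.
Qed.

Lemma Sigma02_open (X : topologicalType) (A : set X) : open A -> Sigma02 A.
Proof.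
move=> oA; exists (fun=> A), (fun=> set0); split=> //; first by move=> _; exact: open0.
by apply/seteqP; split=> x; [move=> Ax; exists 0 => //; split|case=> ? _ []].
Qed.

Lemma Sigma1_preimage n (X Y : topologicalType) (f : X -> Y) (A : set Y) :
  continuous f -> Sigma1 n A -> Sigma1 n (f @^-1` A).
Proof.
elim: n X Y f A => [|n IH] X Y f A cf.
  move=> [U [V [oU oV ->]]].
  exists (fun i => f @^-1` (U i)), (fun i => f @^-1` (V i)); split=> [i|i|].
  - by apply: open_comp => // ? _; exact: cf.
  - by apply: open_comp => // ? _; exact: cf.
  - by rewrite preimage_bigcup.
move=> [B SB ->]; exists ((fun rx => (rx.1, f rx.2)) @^-1` B : set (baire * X)).
  rewrite preimage_setC; apply: IH SB; apply: continuous_pair.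
    exact: continuous_fst.
  exact: continuous_compT (@continuous_snd _ _) cf.
by apply/seteqP; split=> x [r h]; exists r.
Qed.

(** The complement taken at each level exchanges union with an open set and intersection with a
    closed one, so the two claims are proved by one induction. *)
Lemma Sigma1_setU_setI n (X : topologicalType) (A B : set X) :
  Sigma1 n A ->
  (open B -> Sigma1 n (A `|` B)) /\ (closed B -> Sigma1 n (A `&` B)).
Proof.
elim: n X A B => [|n IH] X A B.
  move=> SA; split=> [oB|]; last exact: Sigma02_setI_closed.
  by apply: Sigma02_setU => //; exact: Sigma02_open.
have csnd := @continuous_snd baire X.
move=> [C SC ->]; split=> hB.
  exists (C `|` snd @^-1` B).
    rewrite setCU; apply: (IH _ _ _ SC).2.
    by apply: open_closedC; apply: open_comp.
  apply/seteqP; split=> x; first by move=> [[p h]|h]; [exists p; left|exists point; right].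
  by move=> [p [h|h]]; [left; exists p|right].
exists (C `&` snd @^-1` B).
  rewrite setCI; apply: (IH _ _ _ SC).1.
  by apply: closed_openC; apply: preimage_closed.
apply/seteqP; split=> x; first by move=> [[p h] Bx]; exists p.
by move=> [p [h Bx]]; split=> //; exists p.
Qed.

(** The default [(0, 0)] makes the decoding total, whether or not [c] codes a pair. *)
Definition pr1n (c : nat) : nat := (odflt (0, 0) (unpickle c)).1.
Definition pr2n (c : nat) : nat := (odflt (0, 0) (unpickle c)).2.
Definition pairn (a b : nat) : nat := pickle (a, b).

Lemma pr1nK a b : pr1n (pairn a b) = a.
Proof. by rewrite /pr1n /pairn pickleK. Qed.

Lemma pr2nK a b : pr2n (pairn a b) = b.
Proof. by rewrite /pr2n /pairn pickleK. Qed.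

Definition pairb (p q : nat -> nat) : baire := fun i => pairn (p i) (q i).
Definition pr1b (p : nat -> nat) : baire := fun i => pr1n (p i).
Definition pr2b (p : nat -> nat) : baire := fun i => pr2n (p i).

Lemma pr1bK p q : pr1b (pairb p q) = p.
Proof. by apply/funext => i; rewrite /pr1b pr1nK. Qed.

Lemma pr2bK p q : pr2b (pairb p q) = q.
Proof. by apply/funext => i; rewrite /pr2b pr2nK. Qed.

Lemma continuous_pointwise (g : nat -> nat) :
  continuous (fun p : baire => (fun i => g (p i)) : baire).
Proof.
move=> p; apply: cvg_baire_coord => i.
by apply: filterS (nbhs_agree p i.+1) => q pq; rewrite pq.
Qed.

Lemma continuous_pr1b : continuous (pr1b : baire -> baire).
Proof. exact: continuous_pointwise. Qed.

Lemma continuous_pr2b : continuous (pr2b : baire -> baire).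
Proof. exact: continuous_pointwise. Qed.

(** Two successive quantifiers over the Baire space merge into one by pairing. *)
Lemma Sigma1_pr n (X : topologicalType) (A : set (baire * X)) :
  Sigma1 n.+1 A -> Sigma1 n.+1 (pr A).
Proof.
move=> [B SB ->].
exists ((fun rx : baire * X => (pr1b rx.1, (pr2b rx.1, rx.2))) @^-1` B).
  rewrite preimage_setC; apply: Sigma1_preimage SB.
  have cf := continuous_compT (@continuous_fst baire X).
  apply: continuous_pair; first by apply: (cf); exact: continuous_pr1b.
  apply: continuous_pair; first by apply: (cf); exact: continuous_pr2b.
  exact: continuous_snd.
apply/seteqP; split=> x.
  by move=> [p [r /= h]]; exists (pairb r p); rewrite /= pr1bK pr2bK.
by move=> [r h]; exists (pr2b r), (pr1b r).
Qed.

(** * Convergence in the exponentials *)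

Definition sequential (X : topologicalType) :=
  forall A : set X, seq_open A -> open A.

Lemma not_near_subseq (P : nat -> Prop) :
  ~ (\forall n \near \oo, P n) ->
  exists f : nat -> nat, forall n, n <= f n /\ ~ P (f n).
Proof.
move=> nP.
suff /choice[f hf] : forall n, exists m, n <= m /\ ~ P m by exists f.
move=> n; apply: contrapT => /forallNP h; apply: nP.
by exists n => // m nm; apply: contrapT => nPm; apply: (h m).
Qed.

Lemma cvg_subseq (X : topologicalType) (u : nat -> X) (l : X) (f : nat -> nat) :
  (forall n, n <= f n) -> u @ \oo --> l -> (u \o f) @ \oo --> l.
Proof.
move=> hf ul A /ul [N _ hN]; exists N => // n /= Nn.
by apply: hN; exact: leq_trans Nn (hf n).
Qed.

(** A neighbourhood of [l] absorbs a tail of [u]; the finitely many remaining terms are handled one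
    by one. *)
Lemma compact_seq (X : topologicalType) (u : nat -> X) (l : X) :
  u @ \oo --> l -> compact (l |` range u).
Proof.
move=> ul; apply/compact_near_coveringP => I F P FF cov.
have Pl : \forall x' \near l & i \near F, P i x' by apply: cov; left.
have Pu n : \forall i \near F, P i (u n).
  case: (cov (u n)); first by right; exists n.
  move=> [V W] /= [Vu FW] VW; apply: filterS FW => i Wi.
  by apply: (VW (u n, i)); split=> //; exact: nbhs_singleton.
case: Pl => -[V W] /= [Vl FW] VW.
have [N _ hN] := ul _ Vl.
have PN : \forall i \near F, forall n, n < N -> P i (u n).
  elim: N {hN} => [|N IH]; first exact: filterE.
  apply: filterS2 IH (Pu N) => i IHi PiN n.
  by rewrite ltnS leq_eqVlt => /predU1P[->|/IHi].
apply: filterS2 FW PN => i Wi PNi x [->|[n _ <-]].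
  by apply: (VW (l, i)); split=> //=; exact: nbhs_singleton.
have [/PNi//|Nn] := ltnP n N.
by apply: (VW (u n, i)); split=> //=; exact: hN.
Qed.

(* [e x] is the only cluster value of a subsequence chosen so that its image
   converges, and injectivity of [e] pulls this back to [x]. *)
Lemma compact_seq_compact (X : topologicalType) (e : X -> baire) (K : set X)
    (w : nat -> X) :
  continuous e -> injective e -> compact K -> (forall n, K (w n)) ->
  exists f : nat -> nat, (forall n, n <= f n) /\
  exists2 x, K x & (w \o f) @ \oo --> x.
Proof.
move=> ce ie cK Kw.
have KF (v : nat -> X) : (forall n, K (v n)) -> exists2 x, K x & cluster (v @ \oo) x.
  move=> Kv; have [|x [Kx clx]] := cK (v @ \oo); last by exists x.
  by exists 0 => // n _; exact: Kv.
have [x Kx clx] := KF _ Kw.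
have /choice[f hf] : forall n, exists m, n <= m /\ agree n (e x) (e (w m)).
  move=> n; have [|y [[m /= nm <-] h]] :=
    clx (w @` [set m | n <= m]) [set y | agree n (e x) (e y)] _ (ce x _ (nbhs_agree _ _)).
    by exists n => // m nm; exists m.
  by exists m.
exists f; split; first by move=> n; have [] := hf n.
exists x => // A; rewrite nbhsE => -[B [oB Bx] BA].
apply: contrapT => /not_near_subseq[g hg].
have [y Ky cly] := KF (w \o f \o g) (fun=> Kw _).
have exy : e x = e y.
  apply/funext => i; have [|z [[m /= im <-] h]] :=
    cly ((w \o f \o g) @` [set m | i.+1 <= m]) [set z | agree i.+1 (e y) (e z)] _
      (ce y _ (nbhs_agree _ _)).
    by exists i.+1 => // m nm; exists m.
  rewrite h//; apply: (hf _).2.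
  by apply: leq_trans im _; have [] := hg m.
move/ie : exy => exy; subst y.
have rng : ((w \o f \o g) @ \oo) (range (w \o f \o g)).
  by exists 0 => // m _; exists m.
have [z [[m _ <-] Bz]] :=
  cly (range (w \o f \o g)) B rng
  (open_nbhs_nbhs (conj oB Bx)).
by have [_] := hg m; apply; exact: BA.
Qed.

Lemma open_sequentialization (T : topologicalType)
    (A : set (sequentialization T)) : open A <-> @seq_open T A.
Proof. by []. Qed.

Section Exponential.
Context {X : topologicalType}.
Implicit Types (f : qcb_exp X nat).

Definition app (f : qcb_exp X nat) : X -> nat := (f : continuousType X nat).

Lemma app_cts f : continuous (app f).
Proof. exact: (@cts_fun X nat f). Qed.

Lemma app_inj f g : app f =1 app g -> f = g.
Proof. by move=> h; apply/continuousEP. Qed.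

Definition mkexp (f : X -> nat) (cf : continuous f) : qcb_exp X nat :=
  (mkcts cf : continuousType X nat).

Lemma app_mkexp f (cf : continuous f) x : app (mkexp cf) x = f x.
Proof. by []. Qed.

Lemma app_near f x : \forall y \near x, app f y = app f x.
Proof. exact: ((continuous_natP (app f)).1 (@app_cts f)). Qed.

(** Sequentialization does not change which sequences converge, so the compact-open criterion
    carries over; [O] is arbitrary because [nat] is discrete. *)
Lemma cvg_expP (u : nat -> qcb_exp X nat) (l : qcb_exp X nat) :
  u @ \oo --> l <-> forall (K : set X) (O : set nat), compact K ->
    (forall x, K x -> O (app l x)) ->
    \forall n \near \oo, forall x, K x -> O (app (u n) x).
Proof.
have -> : u @ \oo --> l <->
    (u : nat -> cts_compact_open X nat) @ \oo --> (l : cts_compact_open X nat).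
  split=> ul A.
    rewrite nbhsE => -[B [oB Bl] BA]; apply: filterS BA _; apply: ul.
    apply: open_nbhs_nbhs; split=> //; apply/open_sequentialization.
    by move=> v m vm Bm; apply: vm; exact: open_nbhs_nbhs.
  rewrite nbhsE => -[B [/open_sequentialization oB Bl] BA].
  by apply: filterS BA _; exact: oB ul Bl.
pose F : set_system {compact-open, X -> nat} := (fun n => app (u n)) @ \oo.
have -> : ((u : nat -> cts_compact_open X nat) @ \oo --> (l : cts_compact_open X nat))
    <-> F --> (app l : {compact-open, X -> nat}).
  split=> ul A.
    move=> lA.
    pose S : set (cts_compact_open X nat) := (fun f => app f) @^-1` A.
    have lS : nbhs (l : cts_compact_open X nat) S by apply/nbhs_initialP; exists A.
    exact: (ul S lS).
  by move=> /nbhs_initialP[B lB BA]; apply: filterS BA _; exact: ul.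
rewrite compact_open_cvgP; split=> h K O cK.
  move=> lKO; have [|N _ hN] := h K O cK (@discrete_open _ O).
    by move=> _ [x Kx <-]; exact: lKO.
  by exists N => // n Nn x Kx; apply: (hN n Nn); exists x.
move=> oO lKO; have [|N _ hN] := h K O cK.
  by move=> x Kx; apply: lKO; exists x.
by exists N => // n Nn _ [x Kx <-]; exact: (hN n Nn).
Qed.

(** A sequence converging in the compact-open topology also converges in its sequentialization, so
    sequentializing again adds no open set. *)
Lemma exp_sequential : sequential (qcb_exp X nat).
Proof.
move=> A oA; apply/open_sequentialization => u l ul Al; apply: oA Al => B.
rewrite nbhsE => -[C [/open_sequentialization oC Cl] CB].
by apply: filterS CB _; exact: oC ul Cl.
Qed.

(** A tail of [v] on which [app l] equals [app l x] is compact together with [x], and the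
    compact-open criterion applies to this set. *)
Lemma cvg_exp_app (u : nat -> qcb_exp X nat) l (v : nat -> X) x :
  u @ \oo --> l -> v @ \oo --> x ->
  \forall n \near \oo, app (u n) (v n) = app l x.
Proof.
move=> ul vx; have [N _ hN] := vx _ (app_near l x).
have vNx : (fun n => v (N + n)) @ \oo --> x.
  by apply: cvg_subseq vx => n; exact: leq_addl.
have /cvg_expP/(_ _ [set app l x] (compact_seq vNx)) [|M _ hM] := ul.
  by move=> y [->//|[n _ <-]]; apply: hN => /=; exact: leq_addr.
exists (maxn N M) => // n /=; rewrite geq_max => /andP[Nn Mn].
by apply: hM => //; right; exists (n - N) => //; rewrite subnKC.
Qed.

(** If convergence fails, some [K] and [O] are violated along a subsequence of [u], at points of [K]
    that can be thinned to a convergent sequence. Hence the subsequences [f] in the hypothesis. *)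
Lemma cvg_exp_seqI (e : X -> baire) (u : nat -> qcb_exp X nat) l :
  continuous e -> injective e ->
  (forall (f : nat -> nat) (v : nat -> X) x,
    (forall n, n <= f n) -> v @ \oo --> x ->
    \forall n \near \oo, app (u (f n)) (v n) = app l x) ->
  u @ \oo --> l.
Proof.
move=> ce ie h; apply/cvg_expP => K O cK lKO.
apply: contrapT => /not_near_subseq[f hf].
have /choice[w hw] : forall n, exists x, K x /\ ~ O (app (u (f n)) x).
  by move=> n; have [_ /existsNP[x /not_implyP[]]] := hf n; exists x.
have Kw n : K (w n) by have [] := hw n.
have [g [gn [x Kx wx]]] := compact_seq_compact ce ie cK Kw.
have [|N _ /(_ N (leqnn N)) hN] := h (f \o g) _ _ _ wx.
  by move=> n; apply: leq_trans (gn n) _; have [] := hf (g n).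
have [_] := hw (g N); apply.
by rewrite /= in hN; rewrite hN; exact: lKO.
Qed.

Lemma exp_kolmogorov : kolmogorov_space (qcb_exp X nat).
Proof.
move=> f g /eqP fg.
have [x fgx] : exists x, app f x <> app g x.
  by apply/existsNP => h; exact/fg/app_inj.
exists [set h | app h x = app f x]; left; split.
  rewrite inE; apply: open_nbhs_nbhs; split=> //; apply: exp_sequential.
  move=> u l ul <-; apply: cvg_exp_app ul (cvg_cst x).
by rewrite inE /= => /esym.
Qed.

Lemma app_eval_cts x : continuous (fun f => app f x).
Proof.
apply/continuous_natP => f; apply: open_nbhs_nbhs; split=> //.
by apply: exp_sequential => u l ul <-; exact: cvg_exp_app ul (cvg_cst x).
Qed.

End Exponential.

(** * Lifting through admissible representations *)

Lemma mkseq_agree n p q : mkseq p n = mkseq q n <-> agree n p q.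
Proof.
split=> [h i ilt|h]; first by rewrite -(nth_mkseq 0 p ilt) h nth_mkseq.
by apply/eq_in_map => i; rewrite mem_iota add0n => /h.
Qed.

Section InitialBaire.
Context (S : choiceType) (f : S -> baire).

Let cyl (s : seq nat) : set (initial_topology f) :=
  [set x | mkseq (f x) (size s) = s].

Let cyl_clopen s : clopen (cyl s).
Proof.
have near x : nbhs (x : initial_topology f)
    [set y | agree (size s) (f x) (f y)].
  by apply/nbhs_initialP; exists (agree (size s) (f x) : set baire) => //; exact: nbhs_agree.
split; last rewrite -openC.
  rewrite openE => x xs; apply: filterS (near x) => y /mkseq_agree xy.
  by rewrite /cyl /= -xy.
rewrite openE => x xs; apply: filterS (near x) => y /mkseq_agree xy.
by rewrite /cyl /= -xy.
Qed.

Let cyl_basis : basis (range cyl).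
Proof.
split=> [_ [s _ <-]|x A /nbhs_initialP[B /nbhs_baireP[n nB] BA]].
  exact: (cyl_clopen s).1.
exists (cyl (mkseq (f x) n)); first by split; [exists (mkseq (f x) n)|rewrite /cyl /= size_mkseq].
move=> y; rewrite /cyl /= size_mkseq => /esym/mkseq_agree xy.
by apply: BA; exact: nB.
Qed.

Lemma initial_second_countable : @second_countable (initial_topology f).
Proof.
by exists (range cyl) => //; exact: (sub_countable (card_image_le cyl setT)) (countableP _).
Qed.

Lemma initial_clopen_based : clopen_based (initial_topology f).
Proof. by exists (range cyl) => // _ [s _ <-]. Qed.

Lemma initial_kolmogorov : injective f -> kolmogorov_space (initial_topology f).
Proof.
move=> fi x y /eqP xy.
have [i fxy] : exists i, f x i <> f y i.
  by apply/existsNP => h; apply/xy/fi/funext.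
exists [set z : initial_topology f | f z i = f x i]; left; split; rewrite inE.
  apply/nbhs_initialP; exists [set p : baire | p i = f x i] => //.
  by apply/nbhs_baireP; exists i.+1 => q /(_ i (leqnn _)).
by move=> /esym.
Qed.

End InitialBaire.

Lemma set_type_second_countable (D : set baire) : @second_countable (set_type D).
Proof. exact: (@initial_second_countable (set_type D) set_val). Qed.

(* The coordinates of [c] are the indicators of clopen sets squeezed, whenever
   possible, between two members of a countable base. *)
Lemma clopen_based_coord (Z : topologicalType) :
  clopen_based Z -> @second_countable Z ->
  exists c : Z -> baire, continuous c /\
    forall z O, nbhs z O -> exists n, forall z', agree n (c z) (c z') -> O z'.
Proof.
move=> [C Cclopen [_ Cb]] [B /countable_injP[num num_inj] [Bopen Bb]].
pose sep (U V A : set Z) := C A /\ U `<=` A /\ A `<=` V.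
pose W (k : nat) := [set A | exists U V, [/\ B U, B V, k = pairn (num U) (num V) & sep U V A]].
(* The default [set0] is clopen, so the indicator of [A k] is continuous for every [k]. *)
pose A k := xget set0 (W k).
have A_clopen k : clopen (A k).
  rewrite /A; case: xgetP => [_ -> [U [V [_ _ _ [CA _]]]]|_]; first exact: Cclopen.
  by split; [exact: open0|exact: closed0].
exists (fun z k => `[< A k z >] : nat); split.
  move=> z; apply: cvg_baire_coord => k.
  have [Az|nAz] := pselect (A k z).
    have : nbhs z (A k) by apply: open_nbhs_nbhs; split=> //; exact: (A_clopen k).1.
    by apply: filterS => z' Az'; rewrite !asboolT.
  have : nbhs z (~` A k).
    by apply: open_nbhs_nbhs; split=> //; exact: closed_openC (A_clopen k).2.
  by apply: filterS => z' Az'; rewrite !asboolF.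
move=> z O zO.
have [V [BV Vz] VO] := Bb z O zO.
have [A0 [CA0 A0z] A0V] := Cb z V (open_nbhs_nbhs (conj (Bopen V BV) Vz)).
have [U [BU Uz] UA0] := Bb z A0 (open_nbhs_nbhs (conj (Cclopen A0 CA0).1 A0z)).
pose k := pairn (num U) (num V).
have Wk : W k A0 by exists U, V.
have [U' [V' [BU' BV' eqk [_ [UA AV]]]]] : W k (A k) by by apply: xgetPex; exists A0.
have num_eq P Q : B P -> B Q -> num P = num Q -> P = Q.
  by move=> BP BQ; apply: num_inj; exact: mem_set.
have UU' : U = U'.
  by apply: num_eq => //; rewrite -(pr1nK (num U) (num V)) -/k eqk pr1nK.
have VV' : V = V'.
  by apply: num_eq => //; rewrite -(pr2nK (num U) (num V)) -/k eqk pr2nK.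
subst U' V'; exists k.+1 => z' /(_ k (leqnn _)).
rewrite asboolT; last exact: UA.
by case: asboolP => // /AV /VO.
Qed.

Section Lifting.
Context (X : topologicalType) (D : set baire) (delta : D -> X).

(** A convergent sequence with its limit is a continuous map on the one-point compactification of
    the naturals. This space is embedded by [s] into the Baire space, with [None] as the point at
    infinity, and admissibility lifts the map. *)
Lemma admissible_lift_seq (u : nat -> X) (l : X) :
  admissible delta -> u @ \oo --> l ->
  exists (v : nat -> D) (q : D),
    [/\ v @ \oo --> q, forall n, delta (v n) = u n & delta q = l].
Proof.
move=> [_ lift] ul.
pose s (o : option nat) : baire := fun i => (o == Some i) : nat.
pose Z : topologicalType := initial_topology s.
have si : injective s.
  move=> [m|] [n|] // h.
  - by have := congr1 (fun p : baire => p m) h; rewrite /s eqxx; case: eqP => // -[->].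
  - by have := congr1 (fun p : baire => p m) h; rewrite /s eqxx.
  - by have := congr1 (fun p : baire => p n) h; rewrite /s eqxx.
have snear (z : Z) n : nbhs z [set z' | agree n (s z) (s z')].
  by apply/nbhs_initialP; exists (agree n (s z) : set baire) => //; exact: nbhs_agree.
have none : (fun n => Some n : Z) @ \oo --> (None : Z).
  move=> A /nbhs_initialP[B /nbhs_baireP[N nB] BA]; exists N => // n /= Nn.
  apply: BA; apply: nB => i iN; rewrite /s /=; case: eqP => // -[ni].
  by move: Nn; rewrite leqNgt ni iN.
pose nu (z : Z) : X := if z is Some n then u n else l.
have nu_cts : continuous nu.
  move=> [n|] A /= nA.
    apply: filterS (snear (Some n) n.+1) => z /(_ n (leqnn _)).
    rewrite /s eqxx; case: eqP => // -> _; exact: nbhs_singleton.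
  have [N _ hN] := ul A nA.
  apply: filterS (snear None N) => -[n|] h /=; last exact: nbhs_singleton.
  apply: hN => /=; rewrite leqNgt; apply/negP => nN.
  by have := h n nN; rewrite /s eqxx.
have [g gcts gnu] := lift Z (initial_clopen_based s) (initial_second_countable s)
   (initial_kolmogorov si) nu nu_cts.
exists (fun n => g (Some n)), (g None); split.
- exact: (@cvg_comp _ _ _ (fun n => Some n : Z) g _ _ _ none (gcts None)).
- by move=> n; rewrite -gnu.
- by rewrite -gnu.
Qed.

(** Convergent sequences lift to names, so a set with open preimage is sequentially open. *)
Lemma admissible_quotient :
  sequential X -> representation delta -> admissible delta -> quotient_map delta.
Proof.
move=> sX rep adm; split=> // U; split=> oU.
  by apply: open_comp => // p _; exact: adm.1.
apply: sX => u l ul Ul; have [v [q [vq vu ql]]] := admissible_lift_seq adm ul.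
have /vq : nbhs q (delta @^-1` U).
  by apply: open_nbhs_nbhs; split=> //; rewrite /preimage /= ql.
by move=> [N _ hN]; exists N => // n /hN; rewrite /= vu.
Qed.

Lemma continuous_seq_set_type (f : D -> X) :
  (forall (v : nat -> D) q, v @ \oo --> q -> (f \o v) @ \oo --> f q) ->
  continuous f.
Proof.
move=> h q A fqA; apply/nbhs_set_typeP; apply: contrapT => /forallNP nA.
have /choice[v hv] : forall n, exists r : D, agree n (\val q) (\val r) /\ ~ A (f r).
  by move=> n; have /existsNP[r /not_implyP[? ?]] := nA n; exists r.
have vq : v @ \oo --> q.
  apply/cvg_set_typeP => n; exists n => // m nm; apply: agree_le nm _.
  by have [] := hv m.
by have [N _ /(_ N (leqnn _))] := h v q vq A fqA; have [] := hv N.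
Qed.

End Lifting.

(** * The representation of an exponential *)

Definition code (p : nat -> nat) (n : nat) : nat := pickle (mkseq p n).

Lemma code_agree n p q : agree n p q -> code p n = code q n.
Proof. by rewrite /code => /mkseq_agree ->. Qed.

(* [p] names the partial continuous map sending [q] to [v] when the first
   nonzero value of [p] on (codes of) the prefixes of [q] is [v + 1]. *)
Definition evalto (p q : nat -> nat) (v : nat) : Prop :=
  exists2 m, p (code q m) = v.+1 & forall j, j < m -> p (code q j) = 0.

Lemma evalto_fun p q v w : evalto p q v -> evalto p q w -> v = w.
Proof.
move=> [m pm hm] [n pn hn]; have [mn|nm|mn] := ltngtP m n.
- by move: pm; rewrite hn.
- by move: pn; rewrite hm.
- by move: pm; rewrite mn pn => -[].
Qed.

Lemma evalto_open p q v : evalto p q v ->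
  exists n, forall p' q', agree n p p' -> agree n q q' -> evalto p' q' v.
Proof.
(* [b] exceeds the codes of all prefixes at which [p] is read, so agreement below [b] preserves the
   answers. *)
move=> [m pm hm]; pose b := \max_(j < m.+1) (code q j).+1.
exists (maxn m b) => p' q' pp' qq'.
have eqp j : j <= m -> p' (code q' j) = p (code q j).
  move=> jm; rewrite -(@code_agree j q q'); last first.
    by apply: agree_le qq'; rewrite leq_max jm.
  apply/esym/pp'; rewrite leq_max; apply/orP; right.
  exact: (@leq_bigmax _ (fun j : 'I_m.+1 => (code q j).+1) (Ordinal (jm : j < m.+1))).
exists m; first by rewrite eqp.
by move=> j jm; rewrite eqp ?hm// ltnW.
Qed.

Section ExpRepresentation.
Context (X : topologicalType) (D : set baire) (delta : D -> X).

(** A common [v] requires both evaluations to be defined. On the diagonal this says that [p] is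
    total and extensional on names, hence [exp_dom]. *)
Definition sameval (p p' : nat -> nat) : Prop :=
  forall q q' : D, delta q = delta q' ->
    exists2 v, evalto p (\val q) v & evalto p' (\val q') v.

Definition exp_dom : set baire := [set p | sameval p p].

Definition exp_fun (p : nat -> nat) (x : X) : nat :=
  xget 0 [set v | exists2 q : D, delta q = x & evalto p (\val q) v].

Lemma exp_fun_evalto p (q : D) : exp_dom p -> evalto p (\val q) (exp_fun p (delta q)).
Proof.
move=> Dp; rewrite /exp_fun; case: xgetP => [v -> [q' qq' ev]|no].
  have [w ev1 ev2] := Dp _ _ qq'.
  by rewrite (evalto_fun ev ev1).
by have [v ev _] := Dp q q erefl; case: (no v); exists q.
Qed.

Hypothesis delta_rep : representation delta.
Hypothesis delta_adm : admissible delta.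
Hypothesis X_seq : sequential X.

(** Evaluation is an open condition, so values stabilize along lifted convergent sequences; as [X]
    is sequential, this gives continuity. *)
Lemma exp_fun_cts p : exp_dom p -> continuous (exp_fun p).
Proof.
move=> Dp; apply/continuous_natP => x; apply: open_nbhs_nbhs; split=> //.
apply: X_seq => u l ul lx; rewrite -lx.
have [v [q [vq vu ql]]] := admissible_lift_seq delta_adm ul.
have [n hn] := evalto_open (exp_fun_evalto q Dp).
have /cvg_set_typeP/(_ n) := vq.
apply: filterS => k qv; rewrite -vu -ql.
exact: evalto_fun (exp_fun_evalto (v k) Dp) (hn _ _ (agreexx _ _) qv).
Qed.

Definition exp_rep (p : exp_dom) : qcb_exp X nat := mkexp (exp_fun_cts (set_valP p)).

Lemma exp_rep_evalto (p : exp_dom) (q : D) :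
  evalto (\val p) (\val q) (app (exp_rep p) (delta q)).
Proof. exact: exp_fun_evalto (set_valP p). Qed.

Lemma exp_rep_cts (e : X -> baire) :
  continuous e -> injective e -> continuous exp_rep.
Proof.
move=> ce ie; apply: continuous_seq_set_type => v q vq.
apply: cvg_exp_seqI ce ie _ => f w x fge wx.
have [w' [y [w'y w'w yx]]] := admissible_lift_seq delta_adm wx.
have [n hn] := evalto_open (exp_rep_evalto q y).
have /cvg_set_typeP/(_ n) h1 := cvg_subseq fge vq.
have /cvg_set_typeP/(_ n) h2 := w'y.
apply: filterS2 h1 h2 => k h1 h2; rewrite -w'w -yx.
exact: evalto_fun (exp_rep_evalto _ _) (hn _ _ h1 h2).
Qed.

(* The name [g0 z] answers [v + 1] on a prefix [s] as soon as [nu z' (delta q')]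
   is [v] for all [q'] extending [s] and all [z'] close to [z] up to [size s]. *)
Lemma exp_rep_lift (Z : topologicalType) (nu : Z -> qcb_exp X nat) :
  clopen_based Z -> @second_countable Z -> continuous nu ->
  exists2 g : Z -> exp_dom, continuous g & forall z, nu z = exp_rep (g z).
Proof.
move=> Zc Zs nu_cts; have [c [ccts cn]] := clopen_based_coord Zc Zs.
(* Failure at every [n] would give sequences converging to [z] and [q], against [cvg_exp_app]. *)
have joint z (q : D) : exists n, forall z' (q' : D), agree n (c z) (c z') ->
    agree n (\val q) (\val q') -> app (nu z') (delta q') = app (nu z) (delta q).
  apply: contrapT => /forallNP no.
  have /choice[w hw] : forall n, exists w : Z * D, [/\ agree n (c z) (c w.1),
      agree n (\val q) (\val w.2) &
      app (nu w.1) (delta w.2) <> app (nu z) (delta q)].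
    move=> n; have /existsNP[z' /existsNP[q' h]] := no n.
    by exists (z', q'); move: h => /not_implyP[? /not_implyP[? ?]].
  have w1 : (fun n => (w n).1) @ \oo --> z.
    move=> A /cn[n nA]; exists n => // m nm; apply: nA.
    by apply: agree_le nm _; have [] := hw m.
  have w2 : (fun n => (w n).2) @ \oo --> q.
    apply/cvg_set_typeP => n; exists n => // m nm; apply: agree_le nm _.
    by have [] := hw m.
  have nu1 : (fun n => nu (w n).1) @ \oo --> nu z.
    exact: cvg_comp w1 (nu_cts z).
  have de2 : (fun n => delta (w n).2) @ \oo --> delta q.
    exact: cvg_comp w2 (delta_adm.1 q).
  have [N _ /(_ N (leqnn N)) hN] := cvg_exp_app nu1 de2.
  by have [_ _ /(_ hN)] := hw N.
pose W z (s : seq nat) := [set w | exists v : nat, [/\ w = v.+1,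
  (exists q : D, mkseq (\val q) (size s) = s) &
  forall z' (q' : D), agree (size s) (c z) (c z') ->
     mkseq (\val q') (size s) = s -> app (nu z') (delta q') = v]].
(* The default 0 means no answer yet. A nonzero answer on a prefix of [q] is correct, since [z] and
   [q] are among the [z'] and [q'] of [W]. *)
pose g0 z : baire := fun k => if unpickle k is Some s then xget 0 (W z s) else 0.
have g0E z (q : D) m : g0 z (code (\val q) m) = 0 \/
    g0 z (code (\val q) m) = (app (nu z) (delta q)).+1.
  rewrite /g0 /code pickleK; case: xgetP => [w -> [v [-> _ h]]|_]; [right|by left].
  by rewrite (h z q)// size_mkseq.
have g0N z (q : D) : exists m, g0 z (code (\val q) m) != 0.
  have [n hn] := joint z q; exists n.
  rewrite /g0 /code pickleK; case: xgetP => [w -> [v [-> _ h]]//|no].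
  case: (no (app (nu z) (delta q)).+1); exists (app (nu z) (delta q)).
  rewrite size_mkseq; split=> //; first by exists q.
  by move=> z' q' zz' /esym/mkseq_agree; exact: hn.
have g0ev z (q : D) : evalto (g0 z) (\val q) (app (nu z) (delta q)).
  have [m /eqP g0m mmin] := ex_minnP (g0N z q).
  exists m; first by case: (g0E z q m).
  by move=> j jm; apply/eqP/negPn/negP => /mmin; rewrite leqNgt jm.
have g0D z : exp_dom (g0 z).
  move=> q q' qq'; exists (app (nu z) (delta q)); first exact: g0ev.
  by rewrite qq'; exact: g0ev.
exists (fun z => exist _ (g0 z) (mem_set (g0D z))).
  move=> z; apply/cvg_set_typeP => n /=.
  suff gz : g0 @ z --> g0 z by exact: (gz _ (nbhs_agree _ n)).
  apply: cvg_baire_coord => k.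
  rewrite /g0; case: unpickle => [s|]; last exact: filterE.
  have cz : \forall z' \near z, agree (size s) (c z) (c z').
    exact: (ccts z _ (nbhs_agree _ _)).
  apply: filterS cz => z' zz'.
  (* [W z s] depends on [z] only through the first [size s] entries of [c z]. *)
  congr xget; apply/seteqP; split=> w [v [-> ? h]]; exists v; split=> // z2 q2 h2.
    by apply: h; exact: agree_trans (agree_sym zz') h2.
  by apply: h; exact: agree_trans zz' h2.
move=> z; apply: app_inj => x; have [q <-] := delta_rep x.
apply: evalto_fun (g0ev z q) _.
exact: (exp_rep_evalto (exist _ (g0 z) (mem_set (g0D z)))).
Qed.

(** The constant map with value [f] on the Baire space lifts, and any value of the lift names
    [f]. *)
Lemma exp_rep_surj : representation exp_rep.
Proof.
move=> f; pose Z : topologicalType := set_type [set: baire].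
have [g _ gE] := @exp_rep_lift Z (cst f) (@initial_clopen_based _ set_val)
  (@set_type_second_countable _) (@cst_continuous _ _ _).
by exists (g (exist _ (point : baire) (mem_set I))); rewrite -gE.
Qed.

Lemma exp_rep_admissible (e : X -> baire) :
  continuous e -> injective e -> admissible exp_rep.
Proof.
move=> ce ie; split; first exact: exp_rep_cts ce ie.
by move=> Z Zc Zs _ nu nu_cts; exact: exp_rep_lift.
Qed.

Lemma EQ_exp_rep (pp : baire * baire) :
  EQ exp_rep pp <-> sameval pp.1 pp.2.
Proof.
case: pp => p p' /=; split.
  move=> [a [b [[-> ->] ab]]] q q' qq'.
  exists (app (exp_rep a) (delta q)); first exact: exp_rep_evalto.
  by rewrite ab qq'; exact: exp_rep_evalto.
move=> h; have Dp : exp_dom p.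
  move=> q q' qq'; have [v e1 e2] := h _ _ qq'; have [w e3 e4] := h q' q' erefl.
  by exists v => //; rewrite (evalto_fun e2 e4).
have Dp' : exp_dom p'.
  move=> q q' qq'; have [v e1 e2] := h _ _ qq'; have [w e3 e4] := h q q erefl.
  by exists v => //; rewrite (evalto_fun e1 e3).
exists (exist _ p (mem_set Dp)), (exist _ p' (mem_set Dp')); split=> //.
apply: app_inj => x; have [q <-] := delta_rep x.
have [v e1 e2] := h q q erefl.
have -> := evalto_fun (exp_rep_evalto (exist _ p (mem_set Dp)) q) e1.
exact: evalto_fun e2 (exp_rep_evalto (exist _ p' (mem_set Dp')) q).
Qed.

End ExpRepresentation.

(** * Properties carried along the hierarchy *)

(** Invariant of the induction on types. The injection [e] makes compact sets sequentially compact;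
    [pi] serves to plant zeros in the members of a dense sequence and to spread a Baire point over
    the space. *)
Definition good (X : topologicalType) (D : set baire) (delta : D -> X) : Prop :=
  [/\ sequential X, representation delta, admissible delta,
      exists e : X -> baire, continuous e /\ injective e &
      exists pi : X -> nat, continuous pi /\ forall n, exists x, pi x = n].

Definition dense_seq (X : topologicalType) (d : nat -> X) : Prop :=
  forall (x : X) (A : set X), nbhs x A -> exists i, A (d i).

(** One name is picked in each cylinder meeting [D]; by continuity of [delta] the named points are
    dense. *)
Lemma rep_dense_seq (X : topologicalType) (D : set baire) (delta : D -> X) (x0 : X) :
  representation delta -> continuous delta -> exists d : nat -> X, dense_seq d.
Proof.
move=> rep dcts; have [p0 _] := rep x0.
pose W (s : seq nat) := [set p : D | mkseq (\val p) (size s) = s].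
exists (fun k => if unpickle k is Some s then delta (xget p0 (W s)) else x0).
move=> x A xA; have [q qx] := rep x.
have /nbhs_set_typeP[n nA] : nbhs q (delta @^-1` A) by apply: dcts; rewrite qx.
exists (pickle (mkseq (\val q) n)); rewrite pickleK.
apply: (nA (xget p0 (W (mkseq (\val q) n)))).
have : W (mkseq (\val q) n) (xget p0 (W (mkseq (\val q) n))).
  by apply: xgetPex; exists q; rewrite /W /= size_mkseq.
by rewrite {1}/W /= size_mkseq => h; exact/mkseq_agree/esym.
Qed.

Section EvaluationOnDense.
Context (X : topologicalType) (d : nat -> X).

Definition evals (f : qcb_exp X nat) : baire := fun i => app f (d i).

Lemma evals_cts : continuous evals.
Proof.
move=> f; apply: (@cvg_baire_coord _ (nbhs f)) => i.
have h := (continuous_natP _).1 (@app_eval_cts X (d i)) f; exact: h.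
Qed.

(** Both functions are locally constant, so their values at [x] are taken at one common nearby
    [d i]. *)
Lemma evals_inj : dense_seq d -> injective evals.
Proof.
move=> dd f g fg; apply: app_inj => x.
have [i [<- <-]] := dd x _ (filterI (app_near f x) (app_near g x)).
exact: (congr1 (fun p : baire => p i) fg).
Qed.

End EvaluationOnDense.

Lemma good_exp (X : topologicalType) (D : set baire) (delta : D -> X) :
  good delta -> exists (D' : set baire) (delta' : D' -> qcb_exp X nat),
    good delta' /\ forall pp, EQ delta' pp <-> sameval delta pp.1 pp.2.
Proof.
move=> [sX rep adm [e [ce ie]] [pi [cpi pis]]].
exists (exp_dom delta), (exp_rep adm sX); split; last exact: EQ_exp_rep.
have [x0 _] := pis 0.
have [d dd] := rep_dense_seq x0 rep adm.1.
split.
- exact: exp_sequential.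
- exact: exp_rep_surj.
- exact: exp_rep_admissible ce ie.
- by exists (evals d); split; [exact: evals_cts|exact: evals_inj].
- exists (fun f => app f x0); split; first exact: app_eval_cts.
  by move=> n; exists (mkexp (@cst_continuous X nat n)).
Qed.

(* Naming [n] by the constant sequence only makes quantification over names
   countable, so that the equality relation obtained for N<1> is Pi^0_2. *)
Definition const_dom : set baire := [set p | forall i, p i = p 0].
Definition const_rep (p : const_dom) : nat := (\val p : baire) 0.

Lemma const_domP n : const_dom (cst n).
Proof. by []. Qed.

Definition const_point n : const_dom := exist _ (cst n : baire) (mem_set (@const_domP n)).

Lemma const_rep_cst (p : const_dom) : (\val p : baire) = cst (const_rep p).
Proof. by apply/funext => i; exact: (set_valP p). Qed.

Lemma const_rep_lift (Z : topologicalType) (nu : Z -> nat) : continuous nu ->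
  exists2 g : Z -> const_dom, continuous g & forall z, nu z = const_rep (g z).
Proof.
move=> /continuous_natP nu_cts.
exists (fun z => const_point (nu z)) => //.
by move=> z; apply/cvg_set_typeP => n; apply: filterS (nu_cts z) => z' /= ->.
Qed.

Lemma good_const_rep : good const_rep.
Proof.
split.
- by move=> A _; exact: discrete_open.
- by move=> n; exists (const_point n).
- split; last by move=> Z _ _ _ nu; exact: const_rep_lift.
  apply/continuous_natP => p; apply/nbhs_set_typeP; exists 1 => q h.
  by rewrite /const_rep h.
- exists (fun n => cst n : baire); split; last first.
    by move=> m n /(congr1 (fun p : baire => p 0)).
  by move=> n A nA; apply/nbhs_natP; exact: (nbhs_singleton nA).
- exists id; split; first by move=> n.
  by move=> n; exists n.
Qed.

(** * Complexity of equality of names *)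

Lemma open_evalto v : open [set pq : baire * baire | evalto pq.1 pq.2 v].
Proof.
rewrite openE => -[p q] /evalto_open[n hn]; apply/nbhs_baire2P; exists n.
exact: hn.
Qed.

Lemma open_evalto2 (X : topologicalType) (f g f' g' : X -> baire) :
  continuous f -> continuous g -> continuous f' -> continuous g' ->
  open [set x | exists2 v, evalto (f x) (g x) v & evalto (f' x) (g' x) v].
Proof.
move=> cf cg cf' cg'.
pose E v := [set pq : baire * baire | evalto pq.1 pq.2 v].
have -> : [set x | exists2 v, evalto (f x) (g x) v & evalto (f' x) (g' x) v] =
    \bigcup_v ((fun x => (f x, g x)) @^-1` E v `&` (fun x => (f' x, g' x)) @^-1` E v).
  by apply/seteqP; split=> x [v]; [move=> *; exists v|move=> _ []; exists v].
apply: bigcup_open => v _; apply: openI; apply: open_comp (@open_evalto v) => x _.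
  exact: continuous_pair.
exact: continuous_pair.
Qed.

Lemma Pi1_exp0 (E : set (baire * baire)) :
  (forall pp, E pp <-> sameval const_rep pp.1 pp.2) -> Pi1 0 E.
Proof.
move=> hE.
pose V n := [set pp : baire * baire |
   exists2 v, evalto pp.1 (cst n) v & evalto pp.2 (cst n) v].
exists (fun=> setT), V; split.
- by move=> _; exact: openT.
- move=> n; apply: open_evalto2.
  + exact: continuous_fst.
  + exact: cst_continuous.
  + exact: continuous_snd.
  + exact: cst_continuous.
apply/seteqP; split=> pp; last first.
  move=> [n _ [_ nV]] /hE Epp; apply: nV.
  exact: (Epp (const_point n) (const_point n) erefl).
move=> nE; apply: contrapT => nV; apply: nE; apply/hE => q q' qq'.
rewrite !const_rep_cst -qq'; apply: contrapT => h; apply: nV.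
by exists (const_rep q).
Qed.

(** A failure of equality is witnessed by one Baire point coding two names of the same point on
    which [pp.1] and [pp.2] have no common value. That last condition is closed, so the projected
    set stays in the class of [EQ delta]. *)
Lemma Pi1_exp (X : topologicalType) (D : set baire) (delta : D -> X) k
    (E : set (baire * baire)) :
  (forall pp, E pp <-> sameval delta pp.1 pp.2) ->
  Pi1 k (EQ delta) -> Pi1 k.+1 E.
Proof.
move=> hE hk.
pose split_r (x : baire * (baire * baire)) := (pr1b x.1, pr2b x.1).
pose O := [set x : baire * (baire * baire) |
  exists2 v, evalto x.2.1 (pr1b x.1) v & evalto x.2.2 (pr2b x.1) v].
have c1 := @continuous_fst baire (baire * baire)%type.
have c2 := @continuous_snd baire (baire * baire)%type.
have cp1 := continuous_compT c1 continuous_pr1b.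
have cp2 := continuous_compT c1 continuous_pr2b.
exists (split_r @^-1` (EQ delta) `&` ~` O).
  rewrite setCI setCK preimage_setC.
  apply: (Sigma1_setU_setI _ _).1.
    by apply: Sigma1_preimage hk; exact: continuous_pair.
  apply: open_evalto2 => //.
  - exact: continuous_compT c2 (@continuous_fst _ _).
  - exact: continuous_compT c2 (@continuous_snd _ _).
apply/seteqP; split=> pp.
  move=> nE; apply: contrapT => h; apply: nE; apply/hE => q q' qq'.
  apply: contrapT => nv; apply: h; exists (pairb (\val q) (\val q')).
  rewrite /split_r /O /setI /= pr1bK pr2bK; split=> //.
  by exists q, q'.
move=> [r [[q [q' [[rq rq'] qq']]] nO]] /hE h; apply: nO.
by rewrite /O /= rq rq'; exact: h.
Qed.

Lemma kleene_kreisel_good k : exists (D : set baire) (delta : D -> kleene_kreisel k),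
  good delta.
Proof.
elim: k => [|k [D [delta h]]]; first by exists const_dom, const_rep; exact: good_const_rep.
by have [D' [delta' [h' _]]] := good_exp h; exists D', delta'.
Qed.

Lemma kleene_kreisel_Pi1 k :
  exists (D : set baire) (delta : D -> kleene_kreisel k.+1),
    good delta /\ Pi1 k (EQ delta).
Proof.
elim: k => [|k [D [delta [h hk]]]].
  have [D' [delta' [h' hE]]] := good_exp good_const_rep.
  by exists D', delta'; split=> //; exact: Pi1_exp0.
have [D' [delta' [h' hE]]] := good_exp h.
by exists D', delta'; split=> //; exact: Pi1_exp hE hk.
Qed.

Lemma kleene_kreisel_QCB0_Pi1 k : QCB0_class (Pi1 k) (kleene_kreisel k.+1).
Proof.
have [D [delta [[sX rep adm _ _] hk]]] := kleene_kreisel_Pi1 k.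
split; last by exists D, delta.
split; first exact: exp_kolmogorov.
exists (set_type D), delta; split; first exact: set_type_second_countable.
exact: admissible_quotient.
Qed.

(** * Coding projective sets by functionals *)

Definition code2 (x y : nat -> nat) n := pairn (code x n) (code y n).

Lemma code2_agree n x x' y y' :
  agree n x x' -> agree n y y' -> code2 x y n = code2 x' y' n.
Proof. by move=> xx' yy'; rewrite /code2 (code_agree xx') (code_agree yy'). Qed.

Lemma code_inj n m p q : code p n = code q m -> n = m /\ agree n p q.
Proof.
move=> /(pcan_inj pickleK) h.
have nm : n = m by rewrite -(size_mkseq p n) h size_mkseq.
by subst m; split=> //; exact/mkseq_agree.
Qed.

Lemma code2_inj n m x x' y y' :
  code2 x y n = code2 x' y' m -> [/\ n = m, agree n x x' & agree n y y'].
Proof.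
move=> h; have := congr1 pr2n h; have := congr1 pr1n h.
by rewrite !pr1nK !pr2nK => /code_inj[nm xx'] /code_inj[_ yy'].
Qed.

Definition exits (c x y : nat -> nat) (n : nat) : bool :=
  (c (code2 x y n) == 0) || (y n == 0).

(* The sets [{(x, y) | stays c x y}] are the closed sets of pairs all of whose
   [y] are nowhere zero; a [y] with a zero exits for every [c]. *)
Definition stays (c x y : nat -> nat) : Prop := forall n, ~~ exits c x y n.

Lemma exits_agree c c' x x' y y' n :
  c (code2 x y n) = c' (code2 x y n) ->
  agree n x x' -> agree n.+1 y y' -> exits c x y n = exits c' x' y' n.
Proof.
move=> cc' xx' yy'; rewrite /exits cc' yy'// (code2_agree (y' := y') xx')//.
exact: agree_le (leqnSn n) yy'.
Qed.

Lemma closed_stays (R : baire -> baire -> Prop) :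
  (forall (x y : baire) n, R x y -> y n <> 0) ->
  (forall x y : baire, (forall n, exists x' y' : baire, [/\ agree n x x', agree n y y' & R x' y']) ->
    R x y) ->
  exists c : baire, forall x y : baire, R x y <-> stays c x y.
Proof.
move=> Rpos Rclosed.
(* [c] admits exactly the pairs of equally long prefixes of members of [R]. *)
exists (fun k => `[< exists n x y, R x y /\ k = code2 x y n >] : nat) => x y.
split=> [Rxy n|h].
  rewrite /exits negb_or; apply/andP; split; last by apply/eqP; exact: Rpos Rxy.
  by rewrite asboolT//; exists n, x, y.
apply: Rclosed => n; have := h n; rewrite /exits negb_or => /andP[+ _].
case: asboolP => // -[m [x' [y' [Rxy' /code2_inj[nm xx' yy']]]]] _.
by exists x', y'.
Qed.

Definition exit_time (c x y : nat -> nat) : nat :=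
  if pselect (exists n, exits c x y n) is left h then ex_minn h else 0.

Lemma exit_timeE c x y n :
  exits c x y n -> (forall j, j < n -> ~~ exits c x y j) -> exit_time c x y = n.
Proof.
move=> xn hn; rewrite /exit_time; case: pselect => [h|]; last by case; exists n.
case: ex_minnP => m xm mmin; apply/eqP; rewrite eqn_leq mmin//= leqNgt.
by apply/negP => /hn; rewrite xm.
Qed.

Lemma exit_timeP c x y : (exists n, exits c x y n) ->
  exits c x y (exit_time c x y) /\ forall j, j < exit_time c x y -> ~~ exits c x y j.
Proof.
move=> h; rewrite /exit_time; case: pselect => // h'.
case: ex_minnP => m xm mmin; split=> // j jm; apply/negP => /mmin.
by rewrite leqNgt jm.
Qed.

Lemma exit_time_agree c x y : (exists n, exits c x y n) ->
  exists n, forall c' x' y', agree n c c' -> agree n x x' -> agree n y y' ->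
    exit_time c' x' y' = exit_time c x y.
Proof.
move=> /exit_timeP; set m := exit_time c x y => -[xm hm].
(* [b] bounds the arguments at which [c] is read up to the exit; [m.+1] is needed because the zero
   test at [m] reads [y m]. *)
pose b := \max_(j < m.+1) (code2 x y j).+1.
exists (maxn m.+1 b) => c' x' y' cc' xx' yy'.
have eqx j : j <= m -> exits c' x' y' j = exits c x y j.
  move=> jm; apply/esym/exits_agree.
  - apply: cc'; rewrite leq_max; apply/orP; right.
    exact: (@leq_bigmax _ (fun j : 'I_m.+1 => (code2 x y j).+1) (Ordinal (jm : j < m.+1))).
  - by apply: agree_le xx'; rewrite leq_max leqW.
  - by apply: agree_le yy'; rewrite leq_max ltnS jm.
by apply: exit_timeE => [|j jm]; rewrite eqx ?hm// ltnW.
Qed.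

(* Setting [f] to [0] on the clopen set [pi = n] gives functions converging to
   [f], since [pi] is bounded on compact sets. *)
Lemma dense_zero_seq (X : topologicalType) (d0 : nat -> X) (pi : X -> nat)
    (a : nat -> qcb_exp X nat) :
  dense_seq d0 -> continuous pi -> (forall n, exists x, pi x = n) -> dense_seq a ->
  exists d : nat -> qcb_exp X nat,
    dense_seq d /\ forall i, exists j, app (d i) (d0 j) = 0.
Proof.
move=> dd0 /continuous_natP cpi pis da.
pose m (f : qcb_exp X nat) n x := if pi x == n then 0 else app f x.
have m_cts f n : continuous (m f n).
  apply/continuous_natP => x; apply: filterS2 (cpi x) (app_near f x) => y.
  by rewrite /m => -> ->.
have m_cvg f : (fun n => mkexp (m_cts f n)) @ \oo --> f.
  apply/cvg_expP => K O cK fKO.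
  have bnd : \forall n \near \oo, K `<=` [set x | pi x <> n].
    move/compact_near_coveringP : cK => /(_ nat \oo (fun n x => pi x <> n)); apply.
    move=> x _; exists ([set y | pi y = pi x], [set n | pi x < n]).
      by split; [exact: cpi|exists (pi x).+1].
    by move=> [y n] /= [-> xn] h; move: xn; rewrite h ltnn.
  apply: filterS bnd => n hn x Kx; change (O (m f n x)).
  by have /eqP/negPf h := hn x Kx; rewrite /m h; exact: fKO.
exists (fun k => mkexp (m_cts (a (pr1n k)) (pr2n k))); split.
  move=> f A; rewrite nbhsE => -[B [oB Bf] BA].
  have [i Bi] := da f B (open_nbhs_nbhs (conj oB Bf)).
  have [N _ hN] := m_cvg (a i) B (open_nbhs_nbhs (conj oB Bi)).
  by exists (pairn i N); apply: BA; rewrite pr1nK pr2nK; exact: (hN N (leqnn N)).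
move=> k; have [x xk] := pis (pr2n k).
have [j] := dd0 x _ (cpi x); rewrite xk => hj; exists j.
by change (m (a (pr1n k)) (pr2n k) (d0 j) = 0); rewrite /m hj eqxx.
Qed.

Section ExitFunctional.
Context (X : topologicalType) (d0 : nat -> X) (d : nat -> qcb_exp X nat).
Hypothesis d_dense : dense_seq d.
Hypothesis d_zero : forall i, exists j, app (d i) (d0 j) = 0.

Definition exit_seq (c x : nat -> nat) : baire :=
  fun i => exit_time c x (evals d0 (d i)).

Lemma exits_dense c x i : exists n, exits c x (evals d0 (d i)) n.
Proof. by have [j h] := d_zero i; exists j; rewrite /exits /evals h eqxx orbT. Qed.

Lemma exit_seq_agree c x i : exists n, forall c' x', agree n c c' -> agree n x x' ->
  exit_seq c' x' i = exit_seq c x i.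
Proof.
have [n hn] := exit_time_agree (exits_dense c x i).
by exists n => c' x' cc' xx'; apply: hn.
Qed.

(** The existence of an [f] at one type becomes, negated, the existence of a [g] at the next; this
    alternation climbs the projective hierarchy. *)
Lemma exit_seq_range c x :
  (exists g : qcb_exp (qcb_exp X nat) nat, evals d g = exit_seq c x) <->
  ~ exists f : qcb_exp X nat, stays c x (evals d0 f).
Proof.
split=> [[g gE] [f f_stays]|nstay].
  pose v := app g f.
  (* Near [f] the function [g] has value [v], yet a [d i] sharing the first [v.+1] values of [f]
     cannot exit at time [v]. *)
  have [i [gi fi]] := d_dense (filterI (app_near g f)
    (@evals_cts _ d0 f _ (nbhs_agree _ v.+1))).
  have [+ _] := exit_timeP (exits_dense c x i).
  have -> : exit_time c x (evals d0 (d i)) = v.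
    by rewrite /v -gi; exact: (congr1 (fun p : baire => p i) (esym gE)).
  rewrite -(@exits_agree c c x x (evals d0 f))//.
  by apply/negP; exact: f_stays.
have allexit f : exists n, exits c x (evals d0 f) n.
  apply: contrapT => /forallNP h; apply: nstay; exists f => n.
  by apply/negP; exact: h.
have g_cts : continuous (fun f => exit_time c x (evals d0 f)).
  apply/continuous_natP => f; have [n hn] := exit_time_agree (allexit f).
  have near_f : \forall f' \near f, agree n (evals d0 f) (evals d0 f').
    exact: (@evals_cts _ d0 f _ (nbhs_agree _ n)).
  by apply: filterS near_f => f' ff'; exact: hn.
by exists (mkexp g_cts); apply/funext => i.
Qed.

End ExitFunctional.

(** Codes live in the same space as the points [x], which makes a diagonal argument possible. *)
Definition coded (n : nat) (X : topologicalType) (d : nat -> X) : Prop :=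
  forall S : set baire, Sigma1 n S ->
    exists c : baire, forall x, S x <->
      exists f : qcb_exp X nat, stays c x (evals d f).

(* [y] encodes a point [p] of the fibre and, for each [i], a witness that
   [(p, x)] is outside [U i] (value 0) or that the cylinder of length [m] around
   it lies in [V i] (value [m + 1]). *)
Lemma coded_nat : coded 1 (id : nat -> nat).
Proof.
move=> S [B [U [V [oU oV BE]]] ->].
(* Entries of [y] are shifted by one, to be nowhere zero as [stays] demands; [.-1] undoes the
   shift. *)
pose P (y : baire) : baire := fun i => pr1n (y i).-1.
pose W (y : baire) : baire := fun i => pr2n (y i).-1.
pose R (x y : baire) := forall i, [/\ y i <> 0,
  W y i = 0 -> ~ U i (P y, x) &
  forall m, W y i = m.+1 -> forall p' x' : baire, agree m (P y) p' -> agree m x x' -> V i (p', x')].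
have W_agree n (y y' : baire) i : agree n y y' -> i < n -> W y i = W y' i.
  by move=> yy' ilt; rewrite /W yy'.
have P_agree n (y y' : baire) : agree n y y' -> agree n (P y) (P y').
  by move=> yy' i ilt; rewrite /P yy'.
have [c hc] : exists c : baire, forall x y : baire, R x y <-> stays c x y.
  apply: closed_stays => [x y n /(_ n)[]//|x y lim i]; split.
  - have [x' [y' [_ yy' /(_ i)[yi _ _]]]] := lim i.+1.
    by rewrite (yy' i (leqnn _)).
  - move=> Wi Ui.
    have /nbhs_baire2P[n hn] : nbhs (P y, x) (U i) by exact: open_nbhs_nbhs.
    have [x' [y' [xx' yy' /(_ i)[_ + _]]]] := lim (maxn n i.+1).
    apply.
      by rewrite -(W_agree _ _ _ _ yy')// leq_max leqnn orbT.
    apply: hn; last exact: agree_le (leq_maxl _ _) xx'.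
    exact/P_agree/(agree_le (leq_maxl _ _) yy').
  - move=> m Wi p' z Pp xz.
    have [x' [y' [xx' yy' /(_ i)[_ _ h]]]] := lim (maxn m i.+1).
    apply: (h m).
    + by rewrite -(W_agree _ _ _ _ yy')// leq_max leqnn orbT.
    + apply: agree_trans Pp; apply/agree_sym/P_agree.
      exact: agree_le (leq_maxl _ _) yy'.
    + apply: agree_trans xz; apply/agree_sym.
      exact: agree_le (leq_maxl _ _) xx'.
exists c => x.
have BP p : B (p, x) <-> forall i, U i (p, x) -> V i (p, x).
  split=> [Bpx i Ui|h].
    apply: contrapT => nV; suff : (~` B) (p, x) by [].
    by rewrite BE; exists i.
  by apply: contrapT => nB; have : (~` B) (p, x) by []; rewrite BE => -[i _ [/h]].
split=> [[p /BP hp]|[f /hc h]].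
  have /choice[w hw] : forall i, exists w, (w = 0 -> ~ U i (p, x)) /\
      forall m, w = m.+1 -> forall p' x' : baire, agree m p p' -> agree m x x' -> V i (p', x').
    move=> i; have [Ui|nUi] := pselect (U i (p, x)); last by exists 0.
    have /nbhs_baire2P[n hn] : nbhs (p, x) (V i) by apply: open_nbhs_nbhs; split=> //; exact: hp.
    by exists n.+1; split=> // m [<-].
  have y_cts : continuous (fun i => (pairn (p i) (w i)).+1 : nat).
    by apply/continuous_natP => i; exact/nbhs_natP.
  exists (mkexp y_cts); apply/hc => i.
  set y := evals _ _.
  have Py : P y = p by apply/funext => j; rewrite /P /y /evals app_mkexp pr1nK.
  have Wy : W y = w by apply/funext => j; rewrite /W /y /evals app_mkexp pr2nK.
  by rewrite Py Wy; have [] := hw i.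
set y := evals _ _ in h.
exists (P y); apply/BP => i Ui; have [_ W0 WS] := h i.
by case E : (W y i) => [|m]; [case: (W0 E)|apply: (WS m E)].
Qed.

(* [f] encodes a pair [(g, q)]; [q] is spread along the values of [pi], so that it
   can be read off [evals d f] with the help of indices [t] with [pi (d (t j)) = j]. *)
Lemma coded_exp n (X : topologicalType) (d0 : nat -> X) (d : nat -> qcb_exp X nat)
    (pi : qcb_exp X nat -> nat) :
  continuous pi -> (forall j, exists f, pi f = j) -> dense_seq d ->
  (forall i, exists j, app (d i) (d0 j) = 0) ->
  coded n.+1 d0 -> coded n.+2 d.
Proof.
move=> /continuous_natP cpi pis dd dz cod S [B SB ->].
(* The coding one level down is applied to the complement of [B], on paired points; [exit_seq_range]
   turns it back into a statement about [B]. *)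
have [c hc] : exists c : baire, forall q x : baire, B (q, x) <->
    exists g : qcb_exp (qcb_exp X nat) nat, evals d g = exit_seq d0 d c (pairb q x).
  have [|c hc] := cod ((fun w : baire => (pr1b w, pr2b w)) @^-1` (~` B)).
    apply: (@Sigma1_preimage n.+1 baire (baire * baire)%type _ _ _ SB).
    by apply: continuous_pair; [exact: continuous_pr1b|exact: continuous_pr2b].
  exists c => q x; apply: iff_trans (iff_sym (exit_seq_range dd dz c (pairb q x))).
  have := hc (pairb q x); rewrite /preimage /= pr1bK pr2bK => <-.
  by split=> [h|/contrapT].
have /choice[t ht] : forall j, exists i, pi (d i) = j.
  move=> j; have [f fj] := pis j; have [i hi] := dd f _ (cpi f).
  by exists i; rewrite hi.
pose Q (y : baire) : baire := fun j => pr2n (y (t j)).-1.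
pose R (x y : baire) := forall i, [/\ y i <> 0,
  pr2n (y i).-1 = Q y (pi (d i)) &
  pr1n (y i).-1 = exit_seq d0 d c (pairb (Q y) x) i].
have [c' hc'] : exists c' : baire, forall x y : baire, R x y <-> stays c' x y.
  apply: closed_stays => [x y i /(_ i)[]//|x y lim i].
  have [n1 hn1] := exit_seq_agree dz c (pairb (Q y) x) i.
  (* The first [n1] entries of [Q y] are read from [y] at the indices [t j], which [b] bounds. *)
  pose b := \max_(j < n1) (t j).+1.
  have [x' [y' [xx' yy' /(_ i)[y0 y2 y1]]]] :=
    lim (maxn (maxn i.+1 (t (pi (d i))).+1) (maxn n1 b)).
  have yi : y i = y' i by apply: yy'; rewrite !leq_max leqnn.
  have Qi : Q y (pi (d i)) = Q y' (pi (d i)).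
    by rewrite /Q yy'// !leq_max leqnn !orbT.
  have pp : agree n1 (pairb (Q y) x) (pairb (Q y') x').
    move=> j jn; rewrite /pairb xx'; last by rewrite !leq_max jn !orbT.
    rewrite /Q yy'// !leq_max; apply/orP; right; apply/orP; right.
    exact: (@leq_bigmax _ (fun j : 'I_n1 => (t j).+1) (Ordinal jn)).
  rewrite yi Qi; split=> //.
  by rewrite -(hn1 _ _ (agreexx _ _) pp).
exists c' => x; split=> [[q /hc[g gE]]|[f /hc' h]].
  have y_cts : continuous (fun f => (pairn (app g f) (q (pi f))).+1).
    by apply/continuous_natP => f; apply: filterS2 (app_near g f) (cpi f) => f' -> ->.
  exists (mkexp y_cts); apply/hc' => i.
  set y := evals _ _.
  have Qy : Q y = q.
    by apply/funext => j; rewrite /Q /y /evals app_mkexp pr2nK ht.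
  rewrite Qy -gE /y /evals app_mkexp /= pr1nK pr2nK; split=> //.
set y := evals _ _ in h.
exists (Q y); apply/hc.
have g_cts : continuous (fun z => pr1n (app f z).-1).
  by apply/continuous_natP => z; apply: filterS (app_near f z) => z' ->.
by exists (mkexp g_cts); apply/funext => i; have [_ _ <-] := h i.
Qed.

Lemma kleene_kreisel_dense_zero k (d0 : nat -> kleene_kreisel k) :
  dense_seq d0 -> exists d : nat -> kleene_kreisel k.+1,
    dense_seq d /\ forall i, exists j, app (d i) (d0 j) = 0.
Proof.
move=> dd0.
have [_ [_ [_ _ _ _ [pi [cpi pis]]]]] := kleene_kreisel_good k.
have [D [delta [_ rep [dcts _] _ _]]] := kleene_kreisel_good k.+1.
have [a da] := rep_dense_seq (mkexp (@cst_continuous (kleene_kreisel k) nat 0)) rep dcts.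
exact: dense_zero_seq dd0 cpi pis da.
Qed.

Lemma kleene_kreisel_coded k :
  exists d : nat -> kleene_kreisel k, dense_seq d /\ coded k.+1 d.
Proof.
elim: k => [|k [d0 [dd0 cod]]].
  exists id; split; last exact: coded_nat.
  by move=> x A /nbhs_singleton Ax; exists x.
have [d [dd dz]] := kleene_kreisel_dense_zero dd0.
exists d; split=> //.
have [_ [_ [_ _ _ _ [pi [cpi pis]]]]] := kleene_kreisel_good k.+1.
exact: coded_exp cpi pis dd dz cod.
Qed.

(** * The lower bound by diagonalization *)

(* The image is a projection of the graph, which is the trace on [D] of its closure. *)
Lemma Sigma1_image n (Y : topologicalType) (D : set baire) (delta : D -> Y)
    (e : Y -> baire) :
  continuous delta -> continuous e -> Sigma1 n.+1 (EQ delta) ->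
  Sigma1 n.+1 [set h | exists p, e (delta p) = h].
Proof.
move=> cd ce SEQ.
pose cl := [set ph : baire * baire | forall n, exists p : D,
  agree n ph.1 (\val p) /\ agree n ph.2 (e (delta p))].
have cl_closed : closed cl.
  rewrite -openC openE => -[p h] /existsNP[m hm].
  apply/nbhs_baire2P; exists m => p' h' pp' hh' /(_ m)[q [p'q h'q]]; apply: hm.
  by exists q; split; [exact: agree_trans pp' p'q|exact: agree_trans hh' h'q].
pose G := [set ph : baire * baire | D ph.1] `&` cl.
have -> : [set h | exists p, e (delta p) = h] = pr G.
  apply/seteqP; split=> h.
    move=> [p <-]; exists (\val p); split; first exact: set_valP.
    by move=> m; exists p.
  move=> [p [/= Dp clp]].
  pose q : D := exist _ p (mem_set Dp); exists q.
  have ced := continuous_compT cd ce.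
  apply/funext => i.
  have /nbhs_set_typeP[m hm] := ced q _ (nbhs_agree _ i.+1).
  have [r [/= pr hr]] := clp (maxn m i.+1).
  rewrite hr; last by rewrite leq_max leqnn orbT.
  by apply: (hm r _ i (leqnn _)); exact: agree_le (leq_maxl _ _) pr.
apply: Sigma1_pr; apply: (Sigma1_setU_setI _ _).2 => //.
(* [D] inherits its complexity from [EQ delta] along the diagonal. *)
have -> : [set ph : baire * baire | D ph.1] =
    (fun ph : baire * baire => (ph.1, ph.1)) @^-1` (EQ delta).
  apply/seteqP; split=> -[p h] /=.
    by move=> Dp; exists (exist _ p (mem_set Dp)), (exist _ p (mem_set Dp)).
  by move=> [q [q' [[-> _] _]]]; exact: set_valP.
apply: Sigma1_preimage SEQ.
by apply: continuous_pair; exact: continuous_fst.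
Qed.

Lemma kleene_kreisel_not_Sigma1 k :
  ~ QCB0_class (Sigma1 k.+1) (kleene_kreisel k.+2).
Proof.
move=> [_ [D [delta [rep [dcts _] SEQ]]]].
have [d0 [dd0 cod]] := kleene_kreisel_coded k.
have [d [dd dz]] := kleene_kreisel_dense_zero dd0.
(* By [exit_seq_range], [T x] says that no [f] satisfies [stays x x (evals d0 f)]; a code [c] of [T]
   then gives a contradiction at [x = c]. *)
pose T := [set x : baire | exists p : D, evals d (delta p) = exit_seq d0 d x x].
have [|c hc] := cod T.
  pose diag (x : baire) : baire := exit_seq d0 d x x.
  have diag_cts : continuous diag.
    move=> x; apply: cvg_baire_coord => i.
    have [n hn] := exit_seq_agree dz x x i.
    by apply: filterS (nbhs_agree x n) => x' xx'; exact: hn.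
  have SI : Sigma1 k.+1 [set h | exists p : D, evals d (delta p) = h].
    by apply: Sigma1_image => //; exact: evals_cts.
  exact: (@Sigma1_preimage k.+1 baire baire diag _ diag_cts SI).
have : T c <-> ~ T c.
  rewrite {2}hc -(exit_seq_range dd dz); split=> [[p pE]|[g gE]].
    by exists (delta p).
  by have [p pg] := rep g; exists p; rewrite pg.
tauto.
Qed.

Theorem theorem7p7 (k : nat) (k_gt0 : 0 < k) :
  QCB0_class (Pi1 k) (kleene_kreisel k.+1) /\
  ~ QCB0_class (Sigma1 k) (kleene_kreisel k.+1).
Proof.
case: k k_gt0 => // k _; split; first exact: kleene_kreisel_QCB0_Pi1.
exact: kleene_kreisel_not_Sigma1.
Qed.
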